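(* Let $f(X)=\mathrm{trace}(\exp(-X))$, and let $\{X_1^{(k)}\}_{k\ge 0}$ be the sequence of iterates obtained, starting from some $X_1^{(0)}$, by $$X_1^{(k+1)}=M_1+f(X_1^{(k)})\,\Lambda,\qquad k\ge 0,$$ with $M_1\succeq 0$ and $\Lambda\succeq 0$. If $X_1^\star$ is a solution to $X_1=M_1+f(X_1)\,\Lambda$ and we let $E^{(k)}=X_1^{(k)}-X_1^\star$, then for $X_1^{(k)}$ sufficiently close to $X_1^\star$ we have $$E^{(k+1)}=\mathrm{trace}\bigl(\Lambda\exp(-X_1^\star)\bigr)\,E^{(k)}+o(\|E^{(k)}\|)\,\Lambda .$$
   Context: All matrices are $n\times n$, and $\Lambda$ is diagonal. The setting arises from the matrix equation $X=M+f(X)N$ with $N=Q\Lambda Q^{-1}$ diagonalizable, by setting $X_1=Q^{-1}XQ$ and $M_1=Q^{-1}MQ$. The notation $A\succeq 0$ means that $A$ is symmetric and positive semidefinite; $\exp$ is the matrix exponential; $\|\cdot\|$ is a matrix norm, and $o(\|E^{(k)}\|)$ denotes a scalar quantity of smaller order than $\|E^{(k)}\|$ as $E^{(k)}\to 0$.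
   Formalization: The printed coefficient has the wrong sign (n=1, M_1=0, Λ=e, X*=1 gives -E, not +E): the formal statement uses -trace(Λ exp(-X* )); it also takes k≥1, since for k=0 and arbitrary X^(0) the error E^(0) need not be a multiple of Λ. *)

(* Defs.v *)
From HB Require Import structures.
From mathcomp Require Import all_boot all_order all_algebra.
From mathcomp Require Import sesquilinear.
From mathcomp Require Import all_classical all_reals all_analysis.
Import Order.TTheory GRing.Theory Num.Theory.
Import numFieldNormedType.Exports.

Set Implicit Arguments.
Unset Strict Implicit.
Unset Printing Implicit Defensive.

Local Open Scope classical_set_scope.
Local Open Scope ring_scope.

(* The limit is taken in the library's (entrywise) topology on matrices. *)
Definition mexp (R : realType) (n : nat) (A : 'M[R]_n) : 'M[R]_n :=
  lim (series (fun k : nat => (k`!%:R)^-1 *: A ^+ k) @ \oo).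

Definition tr_exp_opp (R : realType) (n : nat) (X : 'M[R]_n) : R :=
  \tr (mexp (- X)).

Definition psd (R : realType) (n : nat) (A : 'M[R]_n) : Prop :=
  A \is symmetricmx /\ forall v : 'cV[R]_n, 0 <= (v^T *m A *m v) ord0 ord0.

(* Submultiplicativity is not required, so this covers every convention for
   what a matrix norm is. *)
Definition is_norm (R : realType) (n : nat) (nrm : 'M[R]_n -> R) : Prop :=
  [/\ forall A B, nrm (A + B) <= nrm A + nrm B,
      forall a A, nrm (a *: A) = `|a| * nrm A &
      forall A, nrm A = 0 -> A = 0].

(* Main.v *)
Require Import Defs.
From HB Require Import structures.
From mathcomp Require Import all_boot all_order all_algebra.
From mathcomp Require Import all_classical all_reals all_analysis.
From mathcomp Require Import ring.
Import Order.TTheory GRing.Theory Num.Theory.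
Import numFieldNormedType.Exports.
Local Open Scope classical_set_scope.
Local Open Scope ring_scope.

(** Every error after the first step is a multiple of [Lam], because both the
    iterates and the solution differ from [M1] by multiples of [Lam], and
    [X k.+1 - Xstar = (f (X k) - f Xstar) *: Lam] where [f X] is the trace of
    [exp (- X)].  So the claim is the first-order expansion of [f] at [Xstar]:
    if [X k - Xstar = c *: Lam], then [f (X k) - f Xstar] is
    [- \tr (Lam exp (- Xstar)) * c] up to [o(c)], and multiplying by [Lam] turns
    [c *: Lam] back into the error.

    The expansion of [\tr (exp (A + E))] is obtained term by term in the
    exponential series.  The part of [(A + E) ^+ k] that is linear in [E] is
    [\sum_(i < k) A ^+ i * E * A ^+ (k.-1 - i)]; [A] and [E] need not commute,
    but cyclicity of the trace turns its trace into [k * \tr (E * A ^+ k.-1)]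
    (mxtrace_sum_expmx), and these terms over [k`!] add up to
    [\tr (E * exp A)].  What remains of [(A + E) ^+ k] is at most
    [n * K ^+ k * `|E| ^+ 2] (norm_expmxBB), with [K] bounded as long as [E] is,
    so the remainders over [k`!] add up to at most
    [n ^+ 2 * expR K * `|E| ^+ 2] (norm_mxtrace_mexpD).

    These estimates use the entrywise maximum norm [`|A|], whereas the theorem
    allows any norm.  Since all errors lie on the line spanned by [Lam], the
    remainder [r] is taken to vanish off that line; and on a line any two norms
    are proportional (max_norm_line_le), which transfers the estimate. *)

(** * The maximum norm and matrix products *)

(** Joins the uniform completeness of matrices with their norm, which makes
    absolutely convergent series of matrices converge. *)
HB.instance Definition _ (R : realType) (m n : nat) := Complete.on 'M[R]_(m, n).

Lemma mxcoord_le_norm (R : realType) (m n : nat) (A : 'M[R]_(m, n)) i j :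
  `|A i j| <= `|A|.
Proof.
rewrite [leRHS]/Num.norm /= mx_normrE; apply/bigmax_geP; right => /=.
by exists (i, j).
Qed.

(** The maximum norm is not submultiplicative: each entry of the product is a
    sum of [n] terms.  This factor [n] is why [n%:R * `|A|], rather than [`|A|],
    appears as the size of [A] in all the estimates on powers. *)
Lemma mxnormM (R : realType) (m n p : nat) (A : 'M[R]_(m, n))
    (B : 'M[R]_(n, p)) : `|A *m B| <= n%:R * `|A| * `|B|.
Proof.
rewrite [leLHS]/Num.norm /= mx_normrE; apply/bigmax_leP; split.
  by rewrite !mulr_ge0.
move=> [i j] _ /=; rewrite mxE (le_trans (ler_norm_sum _ _ _)) //.
have -> : n%:R * `|A| * `|B| = \sum_(k < n) `|A| * `|B|.
  by rewrite sumr_const card_ord -mulrA mulr_natl.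
by apply: ler_sum => k _; rewrite normrM ler_pM ?mxcoord_le_norm.
Qed.

Lemma norm_mxtrace_le (R : realType) (n : nat) (A : 'M[R]_n) :
  `|\tr A| <= n%:R * `|A|.
Proof.
rewrite (le_trans (ler_norm_sum _ _ _)) //.
have -> : n%:R * `|A| = \sum_(k < n) `|A|.
  by rewrite sumr_const card_ord mulr_natl.
by apply: ler_sum => k _; exact: mxcoord_le_norm.
Qed.

(** Bounding [A ^+ k] first and its product with [B] afterwards would cost one
    more factor [n]. *)
Lemma mxnormXM (R : realType) (n : nat) (A B : 'M[R]_n) k :
  `|A ^+ k *m B| <= (n%:R * `|A|) ^+ k * `|B|.
Proof.
elim: k => [|k IHk]; first by rewrite !expr0 mul1r mul1mx.
rewrite !exprS -mulmxE -mulmxA (le_trans (@mxnormM _ _ _ _ _ _)) //.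
by rewrite -[leRHS]mulrA ler_wpM2l // mulr_ge0.
Qed.

(** * The exponential series *)

Lemma is_cvg_mexp (R : realType) (n : nat) (A : 'M[R]_n) :
  cvgn (series (fun k : nat => (k`!%:R)^-1 *: A ^+ k)).
Proof.
apply: (@normed_cvg _ 'M[R]_n).
apply: (@series_le_cvg _ _
  (fun k => `|1%:M : 'M[R]_n| * exp_coeff (n%:R * `|A|) k)).
- by move=> k; exact: normr_ge0.
- by move=> k; rewrite mulr_ge0 // exp_coeff_ge0 // mulr_ge0.
- move=> k; rewrite /= normrZ ger0_norm ?invr_ge0 // /exp_coeff /=.
  rewrite -[A ^+ k]mulmx1 mulrA mulrC ler_wpM2r ?invr_ge0 //.
  by rewrite mulrC mxnormXM.
- exact/is_cvg_seriesZ/is_cvg_series_exp_coeff.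
Qed.

(** Matrix limits are used only through the functionals [X |-> \tr (B *m X)],
    which are linear and bounded, hence pass to the limit of the series. *)
Lemma cvg_mxtrace_mexp (R : realType) (n : nat) (A B : 'M[R]_n) :
  series (fun k : nat => (k`!%:R)^-1 * \tr (B *m A ^+ k)) @ \oo
    --> \tr (B *m mexp A).
Proof.
have BC : continuous ((mxtrace \o mulmx B) : {linear 'M[R]_n -> R}).
  apply/linear_bounded_continuous/linear_boundedP.
  near=> C => X /=; rewrite (le_trans (norm_mxtrace_le _ _ _)) //.
  rewrite (le_trans (ler_wpM2l _ (@mxnormM _ _ _ _ _ _))) // mulrA.
  by rewrite ler_wpM2r.
rewrite (_ : series _ = (mxtrace \o mulmx B) \o
    series (fun k : nat => (k`!%:R)^-1 *: A ^+ k)).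
  exact: cvg_comp (is_cvg_mexp R n A) (BC (mexp A)).
apply/funext => N /=.
rewrite /series /= mulmx_sumr raddf_sum /=; apply: eq_bigr => k _.
by rewrite -scalemxAr mxtraceZ.
Unshelve. all: by end_near.
Qed.

(** * Second-order expansion of the trace of the exponential *)

Section PowerRemainder.
Context (R : realType) (n : nat) (A E : 'M[R]_n) (K : R).
(* The summand 1 lets a single power of K absorb, at each step of the inductions
   below, both the product by A or A + E and the new term. *)
Context (AK : n%:R * `|A| + 1 <= K) (AEK : n%:R * `|A + E| + 1 <= K).

Lemma norm_expmxB k : `|(A + E) ^+ k - A ^+ k| <= K ^+ k * `|E|.
Proof.
have K0 : 0 <= K by apply: le_trans AK; rewrite addr_ge0 // mulr_ge0.
elim: k => [|k IHk]; first by rewrite subrr normr0 mulr_ge0.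
have -> : (A + E) ^+ k.+1 - A ^+ k.+1 =
    ((A + E) ^+ k - A ^+ k) *m (A + E) + A ^+ k *m E.
  by rewrite !exprSr mulmxE mulrBl (mulrDr (A ^+ k)) opprD addrA subrK.
have n0 : 0 <= n%:R * `|A + E| by rewrite mulr_ge0.
rewrite (le_trans (ler_normD _ _)) // exprSr.
have AX : `|A ^+ k *m E| <= K ^+ k * `|E|.
  rewrite (le_trans (mxnormXM _ _ _ _ _)) // ler_wpM2r //.
  rewrite lerXn2r ?nnegrE ?mulr_ge0 //.
  by apply: le_trans AK; rewrite lerDl.
have GX : `|((A + E) ^+ k - A ^+ k) *m (A + E)| <=
    K ^+ k * `|E| * (n%:R * `|A + E|).
  by rewrite (le_trans (@mxnormM _ _ _ _ _ _)) // mulrAC mulrC ler_wpM2r.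
rewrite (le_trans (lerD GX AX)) // -[X in _ + X]mulr1 -mulrDr.
by rewrite -[leRHS]mulrAC ler_wpM2l // mulr_ge0 // exprn_ge0.
Qed.

(** The first-order remainders [Q k] satisfy
    [Q k.+1 = Q k * A + ((A + E) ^+ k - A ^+ k) * E], whose last term is
    already quadratic in [E] by norm_expmxB. *)
Lemma norm_expmxBB k :
  `|(A + E) ^+ k - A ^+ k - \sum_(i < k) A ^+ i * E * A ^+ (k.-1 - i)| <=
    n%:R * K ^+ k * `|E| ^+ 2.
Proof.
have K0 : 0 <= K by apply: le_trans AK; rewrite addr_ge0 // mulr_ge0.
elim: k => [|k IHk].
  by rewrite big_ord0 !subrr normr0 !mulr_ge0.
set S := \sum_(i < k) _ in IHk; set G := (A + E) ^+ k - A ^+ k in IHk.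
have -> : \sum_(i < k.+1) A ^+ i * E * A ^+ (k.+1.-1 - i) = S * A + A ^+ k * E.
  rewrite big_ord_recr /= subnn expr0 mulr1 mulr_suml; congr (_ + _).
  apply: eq_bigr => i _; rewrite -[RHS]mulrA -exprSr; congr (_ * _ ^+ _).
  by case: k i {IHk S G} => [[]//|k] i /=; rewrite subSn // -ltnS.
have -> : (A + E) ^+ k.+1 - A ^+ k.+1 - (S * A + A ^+ k * E) =
    (G - S) *m A + G *m E.
  by rewrite !exprSr mulmxE !mulrBl mulrDr opprD
    [_ + _ - A ^+ k * A]addrAC addrACA.
rewrite (le_trans (ler_normD _ _)) //.
have GS : `|(G - S) *m A| <= n%:R * `|A| * (n%:R * K ^+ k * `|E| ^+ 2).
  by rewrite (le_trans (@mxnormM _ _ _ _ _ _)) // [leLHS]mulrAC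
    ler_wpM2l ?mulr_ge0.
have GE : `|G *m E| <= n%:R * K ^+ k * `|E| ^+ 2.
  rewrite (le_trans (@mxnormM _ _ _ _ _ _)) // expr2 mulrA ler_wpM2r //.
  by rewrite -mulrA ler_wpM2l // norm_expmxB.
rewrite (le_trans (lerD GS GE)) // -[X in _ + X]mul1r -mulrDl [K ^+ k.+1]exprS.
rewrite [n%:R * (K * _)]mulrCA -[leRHS]mulrA ler_wpM2r //.
by rewrite !mulr_ge0 // exprn_ge0.
Qed.

(** By cyclicity of the trace, each summand contributes [\tr (E *m A ^+ k.-1)],
    whatever the position of [E] in the product. *)
Lemma mxtrace_sum_expmx k :
  \tr (\sum_(i < k) A ^+ i * E * A ^+ (k.-1 - i)) = k%:R * \tr (E *m A ^+ k.-1).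
Proof.
rewrite raddf_sum /= -[k in k%:R]card_ord mulr_natl -sumr_const.
apply: eq_bigr => i _.
rewrite -mulrA -mulmxE mxtrace_mulC -mulmxA; congr (\tr (_ *m _)).
by rewrite mulmxE -exprD subnK //; case: k i => [[]//|k] i; rewrite -ltnS.
Qed.

Lemma norm_mxtrace_mexpD :
  `|\tr (mexp (A + E)) - \tr (mexp A) - \tr (E *m mexp A)| <=
    n%:R ^+ 2 * expR K * `|E| ^+ 2.
Proof.
have K0 : 0 <= K by apply: le_trans AK; rewrite addr_ge0 // mulr_ge0.
pose s (B X : 'M[R]_n) :=
  series (fun k : nat => (k`!%:R)^-1 * \tr (B *m X ^+ k)).
have cvgS X : s 1%:M X N.+1 @[N --> \oo] --> \tr (mexp X).
  by rewrite cvg_shiftS -[X in \tr X]mul1mx; exact: cvg_mxtrace_mexp.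
have cvgT : `|s 1%:M (A + E) N.+1 - s 1%:M A N.+1 - s E A N| @[N --> \oo] -->
    `|\tr (mexp (A + E)) - \tr (mexp A) - \tr (E *m mexp A)|.
  apply: cvg_norm; apply: cvgB; last exact: cvg_mxtrace_mexp.
  by apply: cvgB; exact: cvgS.
rewrite -(cvg_lim _ cvgT) //; apply: limr_le.
  by apply/cvg_ex; eexists; exact: cvgT.
apply: nearW => N /=.
(* The linear terms are those of exp A shifted by one index, as k / k! is
   1 / (k - 1)!; hence N terms for the derivative against N.+1 for the others. *)
have -> : s 1%:M (A + E) N.+1 - s 1%:M A N.+1 - s E A N =
   \sum_(0 <= k < N.+1) (k`!%:R)^-1 * \tr ((A + E) ^+ k - A ^+ k -
      \sum_(i < k) A ^+ i * E * A ^+ (k.-1 - i)).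
  have -> : s E A N =
     \sum_(0 <= k < N.+1) (k`!%:R)^-1 * (k%:R * \tr (E *m A ^+ k.-1)).
    rewrite /s /series /= big_nat_recl // mul0r mulr0 add0r.
    apply: eq_bigr => k _.
    by rewrite factS natrM invfM mulrACA mulVf ?mul1r // pnatr_eq0.
  rewrite /s /series /= -!sumrB; apply: eq_bigr => k _.
  by rewrite !raddfB /= mxtrace_sum_expmx !mul1mx !mulrBr.
rewrite (le_trans (ler_norm_sum _ _ _)) //.
have kE k : `|(k`!%:R)^-1 * \tr ((A + E) ^+ k - A ^+ k -
      \sum_(i < k) A ^+ i * E * A ^+ (k.-1 - i))| <=
    n%:R ^+ 2 * `|E| ^+ 2 * exp_coeff K k.
  rewrite normrM ger0_norm ?invr_ge0 // /exp_coeff /= mulrA [leRHS]mulrC.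
  rewrite ler_wpM2l ?invr_ge0 // (le_trans (norm_mxtrace_le _ _ _)) //.
  by rewrite expr2 mulrAC -!mulrA ler_wpM2l // mulrA norm_expmxBB.
rewrite (le_trans (ler_sum _ (fun k _ => kE k))) // -mulr_sumr.
rewrite [leRHS]mulrAC ler_wpM2l ?mulr_ge0 ?exprn_ge0 //.
apply: (nondecreasing_cvgn_le _ (is_cvg_series_exp_coeff K) N.+1).
by apply: nondecreasing_series => k _ _; exact: exp_coeff_ge0.
Qed.
End PowerRemainder.

(** The trace of the exponential is differentiable at [A] with derivative
    [E |-> \tr (E *m mexp A)]; the quadratic remainder has a constant depending
    only on [A] once [E] stays in the unit ball. *)
Lemma norm_mxtrace_mexpD_small (R : realType) (n : nat) (A : 'M[R]_n) :
  exists2 C : R, 0 <= C & forall E : 'M[R]_n, `|E| <= 1 ->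
    `|\tr (mexp (A + E)) - \tr (mexp A) - \tr (E *m mexp A)| <= C * `|E| ^+ 2.
Proof.
exists (n%:R ^+ 2 * expR (n%:R * (`|A| + 1) + 1)).
  by rewrite mulr_ge0 ?exprn_ge0 ?expR_ge0.
move=> E E1; apply: norm_mxtrace_mexpD; rewrite lerD2r ler_wpM2l //.
  by rewrite lerDl.
by rewrite (le_trans (ler_normD _ _)) // lerD2l.
Qed.

(** * Local behaviour of the iteration *)

(** Both norms are proportional to [`|c|] on the line spanned by [B]. *)
Lemma max_norm_line_le (R : realType) (n : nat) (nrm : 'M[R]_n -> R)
    (B : 'M[R]_n) : is_norm nrm ->
  exists2 C : R, 0 <= C & forall c, `|c *: B| <= C * `|nrm (c *: B)|.
Proof.
move=> [_ nrmZ nrm0].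
(* If nrm B = 0 then B = 0, and the constant is then 0 since x / 0 = 0. *)
exists (`|B| / `|nrm B|) => [|c]; first exact: divr_ge0.
have [/nrm0 ->|B0] := eqVneq (nrm B) 0.
  by rewrite scaler0 !normr0 !mul0r.
by rewrite nrmZ normrZ normrM normr_id mulrCA divfK ?normr_eq0.
Qed.

Theorem theorem4p2 (R : realType) (n : nat) (nrm : 'M[R]_n -> R)
    (M1 Lam Xstar : 'M[R]_n) :
  is_norm nrm ->
  psd M1 ->
  psd Lam -> is_diag_mx Lam ->
  Xstar = M1 + tr_exp_opp Xstar *: Lam ->
  exists r : 'M[R]_n -> R,
    r =o_ (0 : 'M[R]_n) nrm /\
    exists delta : R, 0 < delta /\
      forall X : nat -> 'M[R]_n,
        (forall k, X k.+1 = M1 + tr_exp_opp (X k) *: Lam) ->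
        forall k, (0 < k)%N ->
          nrm (X k - Xstar) < delta ->
          X k.+1 - Xstar =
            - \tr (Lam *m mexp (- Xstar)) *: (X k - Xstar)
            + r (X k - Xstar) *: Lam.
Proof.
move=> nrmP _ _ _ XstarE.
pose r (E : 'M[R]_n) := if `[< exists c, E = c *: Lam >] then
  tr_exp_opp (Xstar + E) - tr_exp_opp Xstar + \tr (E *m mexp (- Xstar)) else 0.
exists r; split.
  have [C C0 CP] := norm_mxtrace_mexpD_small R n (- Xstar).
  have [D D0 DP] := max_norm_line_le R n nrm Lam nrmP.
  apply/eqoP => eps eps0.
  have CD0 : 0 < C * D + 1 by rewrite ltr_wpDl // mulr_ge0.
  near=> E.
  have E1 : `|E| <= 1 by near: E; exact: (@nbhs0_le _ 'M[R]_n).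
  have Eeps : `|E| <= eps / (C * D + 1).
    by near: E; apply: (@nbhs0_le _ 'M[R]_n); exact: divr_gt0.
  rewrite /r; case: asboolP => [[c Ec]|_];
    last by rewrite normr0 mulr_ge0 // ltW.
  have := CP (- E); rewrite normrN => /(_ E1).
  rewrite /tr_exp_opp opprD mulNmx raddfN /= opprK => /le_trans; apply.
  have ED : `|E| <= D * `|nrm E| by rewrite Ec.
  rewrite expr2 mulrA (le_trans (ler_wpM2l _ ED)) ?mulr_ge0 //.
  rewrite mulrA ler_wpM2r // mulrAC.
  rewrite ler_pdivlMr // mulrC in Eeps; apply: le_trans Eeps.
  by rewrite ler_wpM2r // lerDl.
(* On the whole line r is the exact remainder, whatever the size of the error,
   so the radius 1 is arbitrary. *)
exists 1; split=> // X XS [//|k] _ _.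
have EL j : X j.+1 - Xstar = (tr_exp_opp (X j) - tr_exp_opp Xstar) *: Lam.
  by rewrite XS [in LHS]XstarE [M1 + _]addrC addrKA scalerBl.
rewrite /r; case: asboolP => [_|[]]; last by eexists; exact: EL.
rewrite [Xstar + _]addrC subrK !EL scalerA -scalerDl -scalemxAl mxtraceZ.
by congr (_ *: _); ring.
Unshelve. all: by end_near.
Qed.
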